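(* Let $k \geq 1$ be an integer and $n = 3k-1$. Let $\mathrm{And}(k)$ denote the Andrásfai graph, i.e. the Cayley graph $\mathrm{Cay}(\mathbb{Z}_n; C)$ where $C = \{3t+1 \mid 0 \leq t \leq k-1\} \subseteq \mathbb{Z}_n$. Then the automorphism group of $\mathrm{And}(k)$ satisfies $\mathrm{Aut}(\mathrm{And}(k)) \cong \mathbb{D}_{2n}$, where $\mathbb{D}_{2n}$ denotes the dihedral group of order $2n$.
   Context: $\mathbb{Z}_n$ is the additive group of integers modulo $n$. For a group $G$ and an inverse-closed subset $\Omega \subseteq G$ not containing the identity, the Cayley graph $\mathrm{Cay}(G;\Omega)$ is the simple undirected graph with vertex set $G$ in which $\{g,h\}$ is an edge iff $g^{-1}h \in \Omega$ (in additive notation, iff $h - g \in \Omega$). The set $C$ consists of the elements of $\mathbb{Z}_{3k-1}$ congruent to $1$ modulo $3$ (as representatives $0,\dots,3k-2$), and it is inverse-closed. $\mathrm{Aut}(\Gamma)$ is the group of all graph automorphisms of $\Gamma$ under composition.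
   Formalization: The theorem is proved for k ≥ 2 instead of k ≥ 1: for k = 1 one has n = 2 and And(1) = K_2, whose automorphism group has order 2, while the dihedral group of order 2n = 4 has order 4, so the claim fails there. *)

(* Defs.v *)
From HB Require Import structures.
From mathcomp Require Import all_boot all_order all_algebra.
From mathcomp Require Import all_fingroup all_solvable.
From mathcomp Require Import zify.

Set Implicit Arguments.
Unset Strict Implicit.
Unset Printing Implicit Defensive.

Import GroupScope GRing.Theory.

(* Adjacency relation of Cay(G; Omega), with G the whole finGroupType; it is a
   simple undirected graph when Omega is inverse-closed and omits 1. *)
Definition cayley (gT : finGroupType) (Omega : {set gT}) : rel gT :=
  fun g h => g^-1 * h \in Omega.

Lemma cayley_sym (gT : finGroupType) (Omega : {set gT}) :
  (forall x, x \in Omega -> x^-1 \in Omega) -> symmetric (cayley Omega).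
Proof.
move=> OV; suff sub g h : cayley Omega g h -> cayley Omega h g.
  by move=> g h; apply/idP/idP; apply: sub.
by rewrite /cayley => /OV; rewrite invMg invgK.
Qed.

Lemma cayley_irrefl (gT : finGroupType) (Omega : {set gT}) :
  1 \notin Omega -> irreflexive (cayley Omega).
Proof. by move=> /negbTE O1 g; rewrite /cayley mulVg. Qed.

Section GraphAutomorphisms.

Variables (T : finType) (e : rel T).

Definition graph_aut : {set {perm T}} :=
  [set s : {perm T} | [forall x, forall y, e (s x) (s y) == e x y]].

Lemma graph_autP (s : {perm T}) :
  reflect (forall x y, e (s x) (s y) = e x y) (s \in graph_aut).
Proof.
rewrite inE; apply: (iffP forallP) => [es x y|es x].
  by apply/eqP; move/forallP: (es x); apply.
by apply/forallP => y; rewrite es.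
Qed.

Lemma graph_aut_group_set : group_set graph_aut.
Proof.
apply/group_setP; split=> [|s t /graph_autP es /graph_autP et].
  by apply/graph_autP => x y; rewrite !perm1.
by apply/graph_autP => x y; rewrite !permM et es.
Qed.

Canonical graph_aut_group := Group graph_aut_group_set.

End GraphAutomorphisms.

Definition andrasfai_order (k : nat) : nat := 3 * k - 1.

Definition andrasfai_set (k : nat) : {set 'Z_(andrasfai_order k)} :=
  [set ((3 * t + 1)%:R)%R | t : 'I_k].

(* The finGroupType structure carried by 'Z_n is the additive one, so the
   adjacency condition g^-1 * h \in C reads h - g \in C. *)
Definition andrasfai (k : nat) : rel 'Z_(andrasfai_order k) :=
  cayley (andrasfai_set k).

Lemma andrasfaiE k (g h : 'Z_(andrasfai_order k)) :
  andrasfai g h = ((h - g)%R \in andrasfai_set k).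
Proof. by rewrite /andrasfai /cayley /mulg /invg /= addrC. Qed.

Lemma andrasfai_setV k x : x \in andrasfai_set k -> x^-1 \in andrasfai_set k.
Proof.
case/imsetP=> t _ ->; apply/imsetP; exists (rev_ord t) => //.
have n_gt1 : 1 < andrasfai_order k by rewrite /andrasfai_order; have := ltn_ord t; lia.
apply/eqP; rewrite /invg /= eq_sym -addr_eq0 -natrD.
suff -> : 3 * (k - t.+1) + 1 + (3 * t + 1) = andrasfai_order k.
  by rewrite pchar_Zp.
by rewrite /andrasfai_order; have := ltn_ord t; lia.
Qed.

Lemma andrasfai_set1 k : 1 \notin andrasfai_set k.
Proof.
apply/imsetP=> -[t _ /(congr1 val)] /=.
have n_gt1 : 1 < andrasfai_order k by rewrite /andrasfai_order; have := ltn_ord t; lia.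
rewrite val_Zp_nat // modn_small; first by rewrite addn1.
by rewrite /andrasfai_order; have := ltn_ord t; lia.
Qed.

Lemma andrasfai_sym k : symmetric (@andrasfai k).
Proof. exact/cayley_sym/andrasfai_setV. Qed.

Lemma andrasfai_irrefl k : irreflexive (@andrasfai k).
Proof. exact/cayley_irrefl/andrasfai_set1. Qed.

(* And(1) = K_2 has automorphism group of order 2, whereas the dihedral group
   of order 2n = 4 has order 4. *)
Lemma andrasfai1_not_dihedral :
  ~~ (graph_aut (@andrasfai 1) \isog 'D_(2 * andrasfai_order 1)).
Proof.
apply/negP => /card_isog; rewrite (@card_dihedral 2) // => c4.
have := subset_leq_card (subsetT (graph_aut (@andrasfai 1))).
rewrite c4 cardsT -[X in _ <= X]cardsT.
have -> : [set: {perm 'Z_(andrasfai_order 1)}] = [set s | perm_on setT s].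
  by apply/setP => s; rewrite !inE; apply/esym/subsetP => x; rewrite inE.
by rewrite cardsE card_perm cardsT card_ord.
Qed.

(* Main.v *)
(** Call [y] a near-twin of [x] when all neighbours of [x], with at most one
    exception, are neighbours of [y].  Every graph automorphism preserves this
    relation, and in And(k), k >= 2, the near-twins of [x] are [x] and
    [x +- 3].  As 3 k = 1 modulo n = 3 k - 1, the steps by 3 form a Hamiltonian
    cycle on Z_n, so an automorphism [s] is a symmetry of this cycle:
    [s x = s 0 +- x].  Conversely all these 2 n maps are automorphisms, and
    they satisfy the dihedral presentation. *)

Require Import Defs.
From mathcomp Require Import all_boot all_order all_algebra.
From mathcomp Require Import all_fingroup all_solvable.
From mathcomp Require Import zify ring.

Set Implicit Arguments.
Unset Strict Implicit.
Unset Printing Implicit Defensive.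

Import GroupScope GRing.Theory.

(** Splits off the wrap-around explicitly, so that residues modulo 3 of representatives can be left
    to [lia]. *)
Lemma val_ZpB (n : nat) (a b : 'Z_n) : 1 < n ->
  (a - b)%R = (if b <= a then a - b else a + n - b) :> nat.
Proof.
case: n a b => [|[|m]] // [a +] [b +] _; rewrite /= /Zp_trunc /= => lta ltb.
rewrite modnDmr; case: leqP => [le_ba|lt_ab].
  have -> : a + (m.+2 - b) = (a - b) + m.+2 by lia.
  by rewrite modnDr modn_small //; lia.
by rewrite modn_small; lia.
Qed.

Lemma natr_Zp_eq0 (n m : nat) : 1 < n -> (m%:R == 0 :> 'Z_n)%R = (n %| m).
Proof. by move=> n_gt1; rewrite -val_eqE [val _]val_Zp_nat. Qed.

Section DihedralMaps.

Variable n : nat.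
Implicit Types (a c x : 'Z_n) (b d : bool).

Definition dihedral_fun a b x : 'Z_n := (a + (-1) ^+ b * x)%R.

Lemma dihedral_fun_inj a b : injective (dihedral_fun a b).
Proof. by move=> x y /addrI /(can_inj (signrMK _)). Qed.

Definition dihedral_perm a b : {perm 'Z_n} := perm (@dihedral_fun_inj a b).

Lemma dihedral_permE a b x : dihedral_perm a b x = (a + (-1) ^+ b * x)%R.
Proof. by rewrite permE. Qed.

Lemma dihedral_permM a b c d :
  dihedral_perm a b * dihedral_perm c d =
  dihedral_perm (c + (-1) ^+ d * a)%R (b (+) d).
Proof.
by apply/permP=> x; rewrite permM !dihedral_permE signr_addb; ring.
Qed.

Lemma dihedral_perm1 : dihedral_perm 0%R false = 1.
Proof. by apply/permP=> x; rewrite perm1 dihedral_permE add0r mul1r. Qed.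

Lemma dihedral_permX a m : dihedral_perm a false ^+ m = dihedral_perm (a *+ m)%R false.
Proof.
elim: m => [|m IHm]; first by rewrite expg0 mulr0n dihedral_perm1.
by rewrite expgS IHm dihedral_permM mul1r mulrSr.
Qed.

(** The value at 0 recovers [a]; the value at 1 then recovers the sign, since 1 and -1 differ modulo
    [n > 2]. *)
Lemma dihedral_perm_inj : 2 < n -> injective (fun ab => dihedral_perm ab.1 ab.2).
Proof.
move=> n_gt2 [a b] [c d] /= /permP eq_s.
have ac : a = c by have := eq_s 0%R; rewrite !dihedral_permE !mulr0 !addr0.
rewrite {}ac in eq_s *; congr (_, _).
have := eq_s 1%R; rewrite !dihedral_permE !mulr1 => /addrI.
have n_gt1 : 1 < n by lia.
have neq : (1 : 'Z_n)%R <> (-1)%R.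
  move=> /eqP; rewrite -subr_eq0 opprK -[(1 + 1)%R]/(2%:R)%R natr_Zp_eq0 //.
  by move=> /(@dvdn_leq _ 2); lia.
by case: b {eq_s}; case: d => //=; rewrite ?expr0 ?expr1 // => /esym.
Qed.

(** [G] has order [2 * n] and is generated by a rotation and a reflection satisfying the dihedral
    presentation. *)
Lemma isog_dihedral_perms (G : {group {perm 'Z_n}}) : 2 < n ->
  (forall s, reflect (exists a b, s = dihedral_perm a b) (s \in G)) ->
  G \isog 'D_(2 * n).
Proof.
move=> n_gt2 GP; have n_gt1 : 1 < n by lia.
rewrite mul2n; apply/(isoGrpP G (Grp_dihedral n_gt1)); split.
  rewrite card_dihedral //.
  have -> : G :=: [set dihedral_perm ab.1 ab.2 | ab : 'Z_n * bool].
    apply/setP=> s; apply/GP/imsetP => [[a [b ->]]|[[a b] _ ->]].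
      by exists (a, b).
    by exists a, b.
  rewrite card_imset; last exact: dihedral_perm_inj.
  by rewrite card_prod card_bool card_ord Zp_cast ?muln2.
set r := dihedral_perm 1%R false; set t := dihedral_perm 0%R true.
have t2 : t ^+ 2 = 1.
  by rewrite expgS expg1 dihedral_permM mulr0 addr0 dihedral_perm1.
apply/existsP; exists (r, t) => /=; rewrite !xpair_eqE.
have -> : (<[r]> <*> <[t]> == G).
  rewrite eqEsubset join_subG !cycle_subG; apply/andP; split.
    by apply/andP; split; apply/GP; do 2!eexists.
  apply/subsetP=> s /GP[a [b ->]].
  have ra : dihedral_perm a false \in <[r]> <*> <[t]>.
    rewrite -[a]natr_Zp -dihedral_permX.
    by rewrite (subsetP (joing_subl _ _)) ?mem_cycle.
  case: b => //; have -> : dihedral_perm a true = t * dihedral_perm a false.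
    by rewrite dihedral_permM mulr0 addr0.
  by rewrite groupM // (subsetP (joing_subr _ _)) ?cycle_id.
rewrite t2 dihedral_permX pchar_Zp // dihedral_perm1 !eqxx /=.
(* The relation [r ^ t = r^-1] is checked in the inverse-free form [r * t * r = t]. *)
rewrite -(inj_eq (mulgI t)) -conjgC -(inj_eq (mulIg r)) mulgKV.
by rewrite !dihedral_permM /= expr1 expr0 !mul1r mulr1 add0r subrr eqxx.
Qed.

End DihedralMaps.

Section NearTwins.

Variables (T : finType) (e : rel T).

Definition near_twin (x y : T) := exists z, forall w, e x w -> e y w \/ w = z.

Lemma near_twin_aut (s : {perm T}) x y :
  s \in graph_aut e -> near_twin x y -> near_twin (s x) (s y).
Proof.
move=> /graph_autP es [z tw]; exists (s z) => w.
by rewrite -(permKV s w) !es => /tw[|->]; [left|right].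
Qed.

End NearTwins.

Local Open Scope nat_scope.

Section Andrasfai.

Variable k : nat.
Hypothesis k_gt1 : 2 <= k.

Local Notation n := (andrasfai_order k).
Local Notation And := (@andrasfai k).

Lemma andrasfai_orderE : n = 3 * k - 1. Proof. by []. Qed.

Lemma andrasfai_order_gt1 : 1 < n.
Proof. by rewrite /andrasfai_order; lia. Qed.

Lemma ltn_andrasfai (x : 'Z_n) : x < n.
Proof. by have := ltn_ord x; rewrite [X in _ < X](Zp_cast andrasfai_order_gt1). Qed.

(** For [t < k], [3 * t + 1] is at most [n - 1], so no reduction modulo [n] takes place. *)
Lemma mem_andrasfai_set (x : 'Z_n) : (x \in andrasfai_set k) = (x %% 3 == 1).
Proof.
have n_gt1 := andrasfai_order_gt1; have ltx := ltn_andrasfai x.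
apply/imsetP/eqP => [[t _ ->]|x1].
  have := ltn_ord t; rewrite val_Zp_nat // andrasfai_orderE => ltt.
  by rewrite (@modn_small _ (3 * k - 1)); lia.
have ltk : x %/ 3 < k by have := andrasfai_orderE; lia.
by exists (Ordinal ltk) => //=; rewrite -[LHS]natr_Zp; congr (_%:R)%R; lia.
Qed.

(** Subtracting 3 keeps the residue modulo 3 of a representative unless it wraps around; among those
    congruent to 1, only 1 itself does, whence the exception [x + 1]. *)
Lemma near_twinD3 (x : 'Z_n) : near_twin And x (x + 3%:R)%R.
Proof.
exists (x + 1)%R => w; rewrite !andrasfaiE opprD addrA !mem_andrasfai_set.
have n_gt1 := andrasfai_order_gt1.
have v3 : (3%:R : 'Z_n)%R = 3 :> nat.
  by rewrite val_Zp_nat // modn_small // andrasfai_orderE; lia.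
have [c1 _|c1 c3] := eqVneq (w - x)%R 1%R; first by right; rewrite -c1 addrC subrK.
left; have {}c1 : val (w - x)%R <> 1%N.
  move=> c1'; move/eqP: c1; apply; apply: val_inj.
  by rewrite c1' /= modn_small // [X in _ < X](Zp_cast n_gt1).
move: c1 c3; rewrite (val_ZpB (w - x)%R 3%:R%R n_gt1) v3.
by move: (w - x)%R => [c ltc] /=; case: leqP; lia.
Qed.

(** Let [d = y - x]. As [n] is 2 modulo 3, the neighbours [x + c] of [x] that [y] misses are those
    with [c < d] if [d] is 0 modulo 3, all of them if [d] is 1, and those with [c >= d] if [d] is 2.
    Unless [d] is 0, 3 or [n - 3], there are at least two. *)
Lemma near_twin_andrasfai (x y : 'Z_n) : near_twin And x y ->
  [\/ y = x, y = (x + 3%:R)%R | y = (x - 3%:R)%R].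
Proof.
case=> z tw; have n_gt1 := andrasfai_order_gt1.
pose d := (y - x)%R; have dy : y = (x + d)%R by rewrite addrC subrK.
have {}tw (c : nat) : c < n -> c %% 3 = 1 ->
    (if d <= c then c - d else c + n - d) %% 3 = 1 \/ val (z - x)%R = c.
  move=> ltc c1; have vc : (c%:R : 'Z_n)%R = c :> nat by rewrite val_Zp_nat ?modn_small.
  have := tw (x + c%:R)%R; rewrite !andrasfaiE dy [(x + _)%R]addrC addrK.
  have -> : (c%:R + x - (x + d) = c%:R - d)%R by ring.
  rewrite !mem_andrasfai_set (val_ZpB c%:R%R d n_gt1) vc c1 => /(_ erefl)[/eqP ?|<-].
    by left.
  by right; rewrite addrK.
have ltd := ltn_andrasfai d.
have : [\/ val d = 0, val d = 3 | val d = n - 3].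
  (* The two smallest and the two largest elements of the connection set suffice as tests; these
     pairs coincide when [k = 2]. *)
  have := tw 1%N; have := tw 4%N; have := tw (3 * k - 2); have := tw (3 * k - 5).
  clear tw dy; move: d ltd (val _) => [v _] /= ltd u.
  move: ltd; rewrite andrasfai_orderE => ltd t1 t2 t3 t4.
  have {}t1 := t1 ltac:(lia) ltac:(lia).
  have {}t2 := t2 ltac:(lia) ltac:(lia).
  have {}t3 := t3 ltac:(lia) ltac:(lia).
  have {}t4 := t4 ltac:(lia) ltac:(lia).
  have [v0|v0] := eqVneq v 0%N; first by constructor 1.
  have [v3|v3] := eqVneq v 3%N; first by constructor 2.
  have [vn|vn] := eqVneq v (3 * k - 1 - 3)%N; first by constructor 3.
  by exfalso; move: t1 t2 t3 t4; do 4!case: leqP => ?; lia.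
rewrite dy => -[] vd; [constructor 1|constructor 2|constructor 3].
- by rewrite -[d]natr_Zp [nat_of_ord d]vd addr0.
- by rewrite -[d]natr_Zp [nat_of_ord d]vd.
by rewrite -[d]natr_Zp [nat_of_ord d]vd natrB ?pchar_Zp ?sub0r // andrasfai_orderE; lia.
Qed.

Lemma mulr3k : (3%:R * k%:R = 1 :> 'Z_n)%R.
Proof.
have n_gt1 := andrasfai_order_gt1.
have k3 : 3 * k = n.+1 by rewrite andrasfai_orderE; lia.
by rewrite -natrM k3 -natr1 pchar_Zp // add0r.
Qed.

Lemma andrasfai_aut_dihedral (s : {perm 'Z_n}) :
  s \in graph_aut And -> exists a b, s = dihedral_perm a b.
Proof.
move=> autS; have n_gt1 := andrasfai_order_gt1.
have step x : exists b : bool, (s (x + 3%:R) = s x + (-1) ^+ b * 3%:R)%R.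
  have := near_twin_andrasfai (near_twin_aut autS (near_twinD3 x)).
  case=> [/perm_inj/eqP||->]; last by exists true; rewrite mulN1r.
    rewrite -subr_eq0 addrC addKr natr_Zp_eq0 //.
    by move=> /(@dvdn_leq _ 3); have := andrasfai_orderE; lia.
  by move=> ->; exists false; rewrite mul1r.
(* If [n] divided 6, then [k = 2] and [n = 5], which is absurd. *)
have neq6 (x : 'Z_n) : (x + 3%:R + 3%:R)%R <> x.
  apply/eqP; rewrite -addrA -subr_eq0.
  rewrite [(x + _)%R]addrC addrK -natrD natr_Zp_eq0 //.
  apply/negP=> n6; have k2 : k = 2.
    by have := @dvdn_leq n 6 erefl n6; have := andrasfai_orderE; lia.
  by move: n6; rewrite andrasfai_orderE k2.
have [b sb] := step 0%R; rewrite add0r in sb.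
(* A change of sign would give [s (x + 6) = s x], against injectivity; so the direction [b] of the
   first step persists. *)
have next x : (s (x + 3%:R) = s x + (-1) ^+ b * 3%:R ->
    s (x + 3%:R + 3%:R) = s (x + 3%:R) + (-1) ^+ b * 3%:R)%R.
  move=> sx; have [c sc] := step (x + 3%:R)%R; rewrite sc.
  have [->//|neq] := eqVneq c b; case: (neq6 x); apply: (@perm_inj _ s).
  by rewrite sc sx; case: b c neq {sb sc sx} => [] [] //= _; ring.
(* The second conjunct records the direction of the next step, which [next] needs in the
   induction. *)
have s3 m : (s (3%:R *+ m) = s 0 + (-1) ^+ b * (3%:R *+ m) /\
    s (3%:R *+ m + 3%:R) = s (3%:R *+ m) + (-1) ^+ b * 3%:R)%R.
  elim: m => [|m [IHm IHm']]; first by rewrite mulr0n mulr0 addr0 add0r.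
  by rewrite mulrSr; split; [rewrite IHm' IHm; ring | apply: next].
exists (s 0%R), b; apply/permP=> x; rewrite dihedral_permE.
(* Since [3 * k = 1] modulo [n], [x] is reached from 0 in [k * x] steps of 3. *)
have [] := s3 (k * x)%N.
by rewrite -mulr_natr natrM natr_Zp mulrA mulr3k mul1r.
Qed.

(** Translations preserve differences; reflections negate them, which the symmetry of adjacency
    absorbs. *)
Lemma dihedral_andrasfai_aut a b : dihedral_perm a b \in graph_aut And.
Proof.
apply/graph_autP=> x y; rewrite !dihedral_permE.
case: b; last by rewrite !andrasfaiE !mul1r opprD addrACA subrr add0r.
rewrite andrasfai_sym !andrasfaiE.
by have -> : (a + (-1) ^+ true * x - (a + (-1) ^+ true * y) = y - x)%R by ring.
Qed.

End Andrasfai.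

Theorem theorem3p3 (k : nat) (hk : 2 <= k) :
  (graph_aut (@andrasfai k) \isog 'D_(2 * andrasfai_order k))%g.
Proof.
apply: isog_dihedral_perms => [|s]; first by rewrite /andrasfai_order; lia.
apply: (iffP idP) => [|[a [b ->]]]; first exact: andrasfai_aut_dihedral.
exact: dihedral_andrasfai_aut.
Qed.
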